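(* Let $q\in(0,1)$, $n\in\mathbb{N}$, $n\ge1$, and let $a,b\in\mathbb{R}$ with $b\ne q^{-m}$ for $m=0,1,2,\dots$ and $aq^j\neq1$ for all integers $j\ge1$. Then the following relations hold identically in $x$: (1) $$-p_n(x;a,q^2b)=\frac{a(1-q^n)(1-abq^{n+3})}{q^{n-2}(1-aq)(1-aq^2)}\,x\,p_{n-1}(x;q^2a,q^2b)-p_n(x;qa,qb);$$ (2) $$(1-aq)\bigl(1+bq^n(aq^{n+1}-aq-1)\bigr)p_n(x;a,b)=(1-bq^n)(1-aq^{n+1})\,p_n\bigl(x;qa,\tfrac bq\bigr)+aq(1-q^n)(1-abq^{n+1})(bqx-1)\,p_{n-1}(x;qa,qb);$$ (3) $$q^n(1-abq^n)\,p_n(x;a,b)=(1-abq^{2n})\,p_n\bigl(qx;a,\tfrac bq\bigr)-(1-q^n)\,p_{n-1}(x;a,b);$$ (4) $$bq^{n+1}(1-aq^{n+1})\,p_{n+1}(x;a,b)=(1-abq^{2n+2})(1-qbx)\,p_n(x;a,qb)-(1-bq^{n+1})\,p_n(x;a,b).$$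
   Context: For $c\in\mathbb{C}$ and an integer $j\ge0$, $(c;q)_0:=1$ and $(c;q)_j:=\prod_{i=0}^{j-1}(1-cq^i)$. The little $q$-Jacobi polynomial with parameters $a,b$ is $$p_n(x;a,b)=p_n(x;a,b|q):=\sum_{j=0}^n\frac{(q^{-n};q)_j\,(abq^{n+1};q)_j}{(aq;q)_j\,(q;q)_j}\,(qx)^j ,$$ and $p_n(qx;a,b)$ denotes this polynomial evaluated at $qx$. *)

(* Defs.v *)
From HB Require Import structures.
From mathcomp Require Import all_boot all_order all_algebra.
From mathcomp Require Import reals complex.

Set Implicit Arguments.
Unset Strict Implicit.
Unset Printing Implicit Defensive.

Import Order.TTheory GRing.Theory Num.Theory.
Local Open Scope ring_scope.

Definition qpoch (F : fieldType) (q c : F) (j : nat) : F :=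
  \prod_(i < j) (1 - c * q ^+ i).

(* p_n(x; a, b | q). Division by zero is total in [F], so this is the intended
   polynomial only when (aq; q)_j and (q; q)_j are nonzero for j <= n. *)
Definition little_qJacobi (F : fieldType) (q : F) (n : nat) (x a b : F) : F :=
  \sum_(j < n.+1)
    (qpoch q (q ^- n) j * qpoch q (a * b * q ^+ n.+1) j)
    / (qpoch q (a * q) j * qpoch q q j) * (q * x) ^+ j.

(* Main.v *)
Require Import Defs.
From HB Require Import structures.
From mathcomp Require Import all_boot all_order all_algebra.
From mathcomp Require Import reals complex.
From mathcomp Require Import ring.

Set Implicit Arguments.
Unset Strict Implicit.
Unset Printing Implicit Defensive.

Import Order.TTheory GRing.Theory Num.Theory.
Local Open Scope ring_scope.
Local Open Scope complex_scope.

(** The four relations are contiguity relations of the terminating series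
    2phi1(q^-n, a b q^(n+1); a q; q, q x), and each of them holds coefficient
    by coefficient in powers of q x.

    Let phi al be ga j = (al)_j (be)_j / ((ga)_j (q)_j).  Multiplying one
    parameter by q changes this coefficient by an explicit rational function of
    y = q^j ([phi_shift_num], [phi_shift_den]), because (c q)_j and (c)_j
    differ only in their end factors.  Multiplying the series by q x moves the
    index j by one, and raising all three parameters moves it back, up to the
    factors (1 - al) (1 - be) and (1 - ga) (1 - y) ([phi_raise]).  Hence in the
    first three relations the coefficient of every term is a rational function
    of y times one common phi al be ga j, and what remains is an identity
    between rational functions of y, q^n, a, b and q.  The upper limits of
    summation do not interfere: (q^-n)_j vanishes for j > n, so every series may
    be summed up to any larger bound ([little_qJacobi_widen]).

    In the fourth relation such a common coefficient would require divisions by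
    factors 1 - a b q^k, which may be zero.  There the coefficients of
    index i + 1 are instead all reduced to the one of index i of the series
    that gets multiplied by x. *)

(** * The q-shifted factorial *)

Lemma qpoch0 (F : fieldType) (q c : F) : qpoch q c 0 = 1.
Proof. by rewrite /qpoch big_ord0. Qed.

Lemma qpochSr (F : fieldType) (q c : F) j :
  qpoch q c j.+1 = qpoch q c j * (1 - c * q ^+ j).
Proof. by rewrite /qpoch big_ord_recr. Qed.

Lemma qpochSl (F : fieldType) (q c : F) j :
  qpoch q c j.+1 = (1 - c) * qpoch q (c * q) j.
Proof.
rewrite /qpoch big_ord_recl expr0 mulr1; congr (_ * _).
by apply: eq_bigr => i _; rewrite /= /bump /= add1n exprS mulrA.
Qed.

(** Both sides are (c)_(j+1), with its first and its last factor split off. *)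
Lemma qpoch_shift (F : fieldType) (q c : F) j :
  (1 - c) * qpoch q (c * q) j = (1 - c * q ^+ j) * qpoch q c j.
Proof. by rewrite -qpochSl qpochSr mulrC. Qed.

Lemma qpoch_neq0 (F : fieldType) (q c : F) j :
  (forall i, c * q ^+ i != 1) -> qpoch q c j != 0.
Proof.
by move=> hc; apply/prodf_neq0 => i _; rewrite subr_eq0 eq_sym hc.
Qed.

Lemma qpoch_eq0 (F : fieldType) (q c : F) n j :
  c * q ^+ n = 1 -> (n < j)%N -> qpoch q c j = 0.
Proof.
move=> hc lt_nj; apply/eqP; rewrite prodf_seq_eq0; apply/hasP.
by exists (Ordinal lt_nj); rewrite ?mem_index_enum //= hc subrr.
Qed.

(** * Coefficients of the basic hypergeometric series *)

Definition phi (F : fieldType) (q al be ga : F) (j : nat) : F :=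
  (qpoch q al j * qpoch q be j) / (qpoch q ga j * qpoch q q j).

(** The coefficients of a power series multiplied by its variable. *)
Definition shift (F : fieldType) (f : nat -> F) (j : nat) : F :=
  if j is i.+1 then f i else 0.

Lemma phiC (F : fieldType) (q al be ga : F) j :
  phi q al be ga j = phi q be al ga j.
Proof. by rewrite /phi [X in X / _]mulrC. Qed.

(** Stated without division because 1 - al may vanish. *)
Lemma phi_shift_num (F : fieldType) (q al be ga : F) j :
  (1 - al) * phi q (al * q) be ga j = (1 - al * q ^+ j) * phi q al be ga j.
Proof. by rewrite /phi !mulrA qpoch_shift. Qed.

Lemma phi_shift_den (F : fieldType) (q al be ga : F) j :
  (forall i, ga * q ^+ i != 1) ->
  phi q al be ga j
  = (1 - ga * q ^+ j) / (1 - ga) * phi q al be (ga * q) j.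
Proof.
move=> hga; have g0 := qpoch_neq0 j hga.
have g1 : qpoch q (ga * q) j != 0.
  by apply: qpoch_neq0 => i; rewrite -mulrA -exprS.
have g2 : 1 - ga != 0 by have := hga 0%N; rewrite mulr1 subr_eq0 eq_sym.
have -> : 1 - ga * q ^+ j = (1 - ga) * qpoch q (ga * q) j / qpoch q ga j.
  by rewrite qpoch_shift mulfK.
(* (q; q)_j may vanish here, so its inverse is kept as an opaque factor *)
rewrite /phi !invfM; move: (qpoch q q j)^-1 => u.
by field; rewrite g0 g1 g2.
Qed.

(** The index-shifted coefficient satisfies the same rule at j = 0 as elsewhere,
    since 1 - q^j vanishes there; this makes a case split on j unnecessary
    wherever the rule is used. *)
Lemma phi_raise (F : fieldType) (q al be ga : F) j :
  (forall i, q ^+ i.+1 != 1) -> ga != 1 ->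
  (1 - al) * (1 - be) * shift (phi q (al * q) (be * q) (ga * q)) j
  = (1 - ga) * (1 - q ^+ j) * phi q al be ga j.
Proof.
move=> hq hga; case: j => [|i] /=; first by rewrite expr0 subrr !(mulr0, mul0r).
have h1 : 1 - ga != 0 by rewrite subr_eq0 eq_sym.
have h2 : 1 - q ^+ i.+1 != 0 by rewrite subr_eq0 eq_sym.
rewrite /phi [qpoch q al _]qpochSl [qpoch q be _]qpochSl [qpoch q ga _]qpochSl.
rewrite [qpoch q q i.+1]qpochSr -exprS !invfM.
move: (qpoch q (ga * q) i)^-1 (qpoch q q i)^-1 => u v.
by field; rewrite h1 h2.
Qed.

(** * Little q-Jacobi polynomials as series of arbitrary length *)

(** The parameters are variables tied by equations so that one rewriting also
    puts them in the form under which they occur in the contiguity relations. *)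
Lemma little_qJacobi_widen (F : fieldType) (q x a b : F) n N (al be ga : F) :
    (n < N)%N -> q != 0 ->
    al * q ^+ n = 1 -> be = a * b * q ^+ n.+1 -> ga = a * q ->
  little_qJacobi q n x a b = \sum_(j < N) phi q al be ga j * (q * x) ^+ j.
Proof.
move=> lt_nN q0 hal -> ->.
have -> : al = q ^- n by rewrite -[LHS](mulfK (expf_neq0 n q0)) hal mul1r.
rewrite /little_qJacobi (big_ord_widen N (fun j => phi q (q ^- n)
  (a * b * q ^+ n.+1) (a * q) j * (q * x) ^+ j)) // big_mkcond /=.
apply: eq_bigr => j _; case: ifP => // /negbT; rewrite -leqNgt => lt_nj.
by rewrite /phi (@qpoch_eq0 _ _ _ n) ?mulVf ?expf_neq0 // !mul0r.
Qed.

Lemma shift_sum (F : fieldType) (f : nat -> F) (z : F) N :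
  z * (\sum_(j < N) f j * z ^+ j) = \sum_(j < N.+1) shift f j * z ^+ j.
Proof.
rewrite big_ord_recl /= mul0r add0r mulr_sumr; apply: eq_bigr => i _.
by rewrite /= /bump /= add1n exprS mulrCA.
Qed.

(** * The four relations over a field *)

(** With al = q^-n and be = a b q^(n+3), the two polynomials of degree n differ
    only in the denominator parameter, a q against a q^2.  Their difference has
    the factor 1 - y, which is what multiplication by x produces. *)
Lemma little_qJacobi_transfer (F : fieldType) (q x a b : F) m :
    q != 0 -> (forall i, q ^+ i.+1 != 1) -> (forall i, a * q ^+ i.+1 != 1) ->
  - little_qJacobi q m.+1 x a (q ^+ 2 * b)
  = a * (1 - q ^+ m.+1) * (1 - a * b * q ^+ (m.+1 + 3))
    / (q ^+ m.+1 / q ^+ 2 * (1 - a * q) * (1 - a * q ^+ 2))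
    * x * little_qJacobi q m x (q ^+ 2 * a) (q ^+ 2 * b)
    - little_qJacobi q m.+1 x (q * a) (q * b).
Proof.
move=> q0 hq ha.
have qm0 : q ^+ m != 0 by rewrite expf_neq0.
have h1 : 1 - a * q != 0 by rewrite subr_eq0 eq_sym (ha 0%N).
have h2 : 1 - a * q * q != 0 by rewrite subr_eq0 eq_sym -mulrA -expr2 (ha 1%N).
pose al := q ^- m.+1; pose be := a * b * q ^+ m.+1 * q ^+ 3.
rewrite (@little_qJacobi_widen _ q x a _ _ m.+2 al be (a * q)) //; last first.
- by rewrite /be !exprS; ring.
- by rewrite mulVf // expf_neq0.
rewrite (@little_qJacobi_widen _ q x (q * a) _ _ m.+2 al be (a * q * q)) //; last first.
- by ring.
- by rewrite /be !exprS; ring.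
- by rewrite mulVf // expf_neq0.
rewrite (@little_qJacobi_widen _ q x (q ^+ 2 * a) _ _ m.+1 (al * q) (be * q)
  (a * q * q * q)) //; last first.
- by ring.
- by rewrite /be !exprS; ring.
- by rewrite /al exprS; field; rewrite q0 qm0.
set S := \sum_(j < m.+1) _.
(* (1 - q^n) / q^n = - (1 - al), the first of the factors needed for raising *)
have -> : a * (1 - q ^+ m.+1) * (1 - a * b * q ^+ (m.+1 + 3))
    / (q ^+ m.+1 / q ^+ 2 * (1 - a * q) * (1 - a * q ^+ 2)) * x * S
  = - (a * q / ((1 - a * q) * (1 - a * q * q))) * ((1 - al) * (1 - be))
    * (q * x * S).
  rewrite /al /be exprD !exprS expr0; field.
  by rewrite qm0 q0 h1 h2.
rewrite /S shift_sum mulr_sumr -!sumrN -big_split /=.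
apply: eq_bigr => j _; rewrite -!(mulNr (phi _ _ _ _ _)) mulrA -mulrDl.
congr (_ * _).
rewrite -[_ * (_ * _) * shift _ _]mulrA phi_raise //; last first.
  by rewrite -mulrA -expr2 (ha 1%N).
rewrite [phi q al be (a * q) j]phi_shift_den; last first.
  by move=> i; rewrite -mulrA -exprS ha.
by field; rewrite h1 h2.
Qed.

(** With al = q^-n and be = a b q^(n+1), the degree-n polynomials have the
    denominator parameters a q and a q^2, and the polynomial of degree n - 1 has
    the parameters al q, be q and a q^2.  It enters both as itself and
    multiplied by x, so both kinds of contiguity are needed. *)
Lemma little_qJacobi_raise_a_lower_b (F : fieldType) (q x a b : F) m :
    q != 0 -> (forall i, q ^+ i.+1 != 1) -> (forall i, a * q ^+ i.+1 != 1) ->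
  (1 - a * q) * (1 + b * q ^+ m.+1 * (a * q ^+ (m.+1 + 1) - a * q - 1))
    * little_qJacobi q m.+1 x a b
  = (1 - b * q ^+ m.+1) * (1 - a * q ^+ (m.+1 + 1))
      * little_qJacobi q m.+1 x (q * a) (b / q)
    + a * q * (1 - q ^+ m.+1) * (1 - a * b * q ^+ (m.+1 + 1)) * (b * q * x - 1)
      * little_qJacobi q m x (q * a) (q * b).
Proof.
move=> q0 hq ha.
have qm0 : q ^+ m != 0 by rewrite expf_neq0.
have h1 : 1 - a * q != 0 by rewrite subr_eq0 eq_sym (ha 0%N).
pose al := q ^- m.+1; pose be := a * b * q ^+ m.+1 * q.
rewrite (@little_qJacobi_widen _ q x a _ _ m.+3 al be (a * q)) //; last first.
- by rewrite /be !exprS; ring.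
- by rewrite mulVf // expf_neq0.
rewrite (@little_qJacobi_widen _ q x (q * a) (b / q) _ m.+3 al be (a * q * q)) //;
  last first.
- by ring.
- by rewrite /be !exprS; field.
- by rewrite mulVf // expf_neq0.
set p' := little_qJacobi q m x _ _.
(* q^n (1 - al) = - (1 - q^n), so the factors needed for raising are present *)
have -> : a * q * (1 - q ^+ m.+1) * (1 - a * b * q ^+ (m.+1 + 1))
    * (b * q * x - 1) * p'
  = a * q * q ^+ m.+1 * ((1 - al) * (1 - be) * p'
    - b * ((1 - al) * (1 - be) * (q * x * p'))).
  by rewrite /al /be addn1 !exprS; field; rewrite q0 qm0.
have p'E N : (m < N)%N ->
    p' = \sum_(j < N) phi q (al * q) (be * q) (a * q * q) j * (q * x) ^+ j.
  move=> lt_mN; apply: little_qJacobi_widen => //.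
  - by rewrite /al exprS; field; rewrite q0 qm0.
  - by rewrite /be !exprS; ring.
  - by ring.
rewrite {1}(p'E m.+3) ?ltnS ?leqW // (p'E m.+2) //.
rewrite shift_sum !mulr_sumr -sumrB mulr_sumr -big_split /=.
apply: eq_bigr => j _; rewrite (mulrA _ (phi q (al * q) _ _ _)).
rewrite (mulrA _ (shift _ _)).
rewrite phi_raise //; last exact: (ha 0%N).
have -> : (1 - al) * (1 - be) * phi q (al * q) (be * q) (a * q * q) j
  = (1 - al * q ^+ j) * (1 - be * q ^+ j) * phi q al be (a * q * q) j.
  rewrite -mulrA [phi _ _ _ _ _]phiC phi_shift_num mulrCA phiC phi_shift_num.
  by rewrite mulrA [X in X * _]mulrC.
rewrite [phi q al be (a * q) j]phi_shift_den; last first.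
  by move=> i; rewrite -mulrA -exprS ha.
rewrite /be /al addn1 !exprS; field.
by rewrite q0 qm0 h1.
Qed.

(** The dilation x -> q x multiplies the coefficient by y = q^j, so it stands on
    the same footing as the shifts of the numerator parameters q^-n and
    a b q^n. *)
Lemma little_qJacobi_dilation (F : fieldType) (q x a b : F) m :
    q != 0 ->
  q ^+ m.+1 * (1 - a * b * q ^+ m.+1) * little_qJacobi q m.+1 x a b
  = (1 - a * b * q ^+ (2 * m.+1)) * little_qJacobi q m.+1 (q * x) a (b / q)
    - (1 - q ^+ m.+1) * little_qJacobi q m x a b.
Proof.
move=> q0.
have qm0 : q ^+ m != 0 by rewrite expf_neq0.
pose al := q ^- m.+1; pose be := a * b * q ^+ m.+1.
rewrite (@little_qJacobi_widen _ q x a b m.+1 m.+2 al (be * q) (a * q)) //; last first.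
- by rewrite /be !exprS; ring.
- by rewrite mulVf // expf_neq0.
rewrite (@little_qJacobi_widen _ q (q * x) a _ _ m.+2 al be (a * q)) //; last first.
- by rewrite /be !exprS; field.
- by rewrite mulVf // expf_neq0.
rewrite (@little_qJacobi_widen _ q x a _ _ m.+2 (al * q) be (a * q)) //; last first.
- by rewrite /al exprS; field; rewrite q0 qm0.
rewrite !mulr_sumr -sumrB; apply: eq_bigr => j _.
rewrite (exprMn j q (q * x)) (mulrA _ (phi q al (be * q) _ _)).
rewrite (mulrA _ (phi q (al * q) _ _ _)).
have -> : q ^+ m.+1 * (1 - a * b * q ^+ m.+1) * phi q al (be * q) (a * q) j
  = q ^+ m.+1 * (1 - be * q ^+ j) * phi q al be (a * q) j.
  by rewrite -/be phiC -[LHS]mulrA phi_shift_num mulrA phiC.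
have -> : (1 - q ^+ m.+1) * phi q (al * q) be (a * q) j
  = - q ^+ m.+1 * (1 - al * q ^+ j) * phi q al be (a * q) j.
  rewrite -mulrA -phi_shift_num mulrA; congr (_ * _).
  by rewrite /al exprS; field; rewrite q0 qm0.
rewrite /be /al mul2n -addnn exprD exprS; field.
by rewrite q0 qm0.
Qed.

(** The three series have the same denominator parameter and numerator
    parameters (al, be q), (al q, be q) and (al q, be), where al = q^-(n+1) and
    be = a b q^(n+1).  The middle one, which is also the one multiplied by x, is
    reached from the other two by moving a factor between the ends. *)
Lemma little_qJacobi_raise_degree (F : fieldType) (q x a b : F) n :
    q != 0 -> (forall i, q ^+ i.+1 != 1) -> (forall i, a * q ^+ i.+1 != 1) ->
  b * q ^+ (n + 1) * (1 - a * q ^+ (n + 1)) * little_qJacobi q (n + 1) x a b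
  = (1 - a * b * q ^+ (2 * n + 2)) * (1 - q * b * x)
      * little_qJacobi q n x a (q * b)
    - (1 - b * q ^+ (n + 1)) * little_qJacobi q n x a b.
Proof.
move=> q0 hq ha; rewrite addn1.
have qn0 : q ^+ n != 0 by rewrite expf_neq0.
pose al := q ^- n.+1; pose be := a * b * q ^+ n.+1.
rewrite (@little_qJacobi_widen _ q x a b n.+1 n.+3 al (be * q) (a * q)) //; last first.
- by rewrite /be !exprS; ring.
- by rewrite mulVf // expf_neq0.
rewrite (@little_qJacobi_widen _ q x a b n n.+3 (al * q) be (a * q)) ?ltnS ?leqW //;
  last first.
- by rewrite /al exprS; field; rewrite q0 qn0.
set p' := little_qJacobi q n x a _.
have -> : (1 - a * b * q ^+ (2 * n + 2)) * (1 - q * b * x) * p'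
   = (1 - be * q ^+ n.+1) * (p' - b * (q * x * p')).
  by rewrite /be mul2n -addnn !(exprD, exprS) expr0; ring.
have p'E N : (n < N)%N ->
    p' = \sum_(j < N) phi q (al * q) (be * q) (a * q) j * (q * x) ^+ j.
  move=> lt_nN; apply: little_qJacobi_widen => //.
  - by rewrite /al exprS; field; rewrite q0 qn0.
  - by rewrite /be !exprS; ring.
rewrite {1}(p'E n.+3) ?ltnS ?leqW // (p'E n.+2) //.
rewrite shift_sum !mulr_sumr -sumrB mulr_sumr -sumrB.
apply: eq_bigr => j _.
(* index 0: every series has constant term 1 and the x-multiple has none *)
case: j => [[|i] lt_i] /=.
  by rewrite /phi !qpoch0 /be !exprS; field; rewrite oner_neq0.
have h1 : 1 - q * q ^+ i != 0 by rewrite -exprS subr_eq0 eq_sym.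
have h2 : 1 - a * q * q ^+ i != 0.
  by rewrite -mulrA -exprS subr_eq0 eq_sym.
(* splitting (al) and (be) at the left and the others at the right end leaves
   the coefficient of index i with numerator parameters al q and be q *)
rewrite /phi [qpoch q al _]qpochSl [qpoch q be _]qpochSl.
rewrite ![qpoch q _ i.+1]qpochSr !invfM.
move: (qpoch q (a * q) i)^-1 (qpoch q q i)^-1 => u v.
rewrite /be /al exprS.
by field; rewrite h1 h2 q0 qn0.
Qed.

(** * The complex case *)

Theorem proposition4p2 (R : realType) (q0 a0 b0 : R) (n : nat)
  (hq : 0 < q0 < 1) (hn : (1 <= n)%N)
  (hb : forall m : nat, b0 != q0 ^- m)
  (ha : forall j : nat, (1 <= j)%N -> a0 * q0 ^+ j != 1) :
  forall x : R[i],
  let q : R[i] := q0%:C in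
  let a : R[i] := a0%:C in
  let b : R[i] := b0%:C in
  let p := little_qJacobi q in
  [/\ - p n x a (q ^+ 2 * b)
      = a * (1 - q ^+ n) * (1 - a * b * q ^+ (n + 3))
        / (q ^ (n%:Z - 2) * (1 - a * q) * (1 - a * q ^+ 2))
        * x * p (n - 1)%N x (q ^+ 2 * a) (q ^+ 2 * b)
        - p n x (q * a) (q * b),
      (1 - a * q) * (1 + b * q ^+ n * (a * q ^+ (n + 1) - a * q - 1))
        * p n x a b
      = (1 - b * q ^+ n) * (1 - a * q ^+ (n + 1)) * p n x (q * a) (b / q)
        + a * q * (1 - q ^+ n) * (1 - a * b * q ^+ (n + 1)) * (b * q * x - 1)
          * p (n - 1)%N x (q * a) (q * b),
      q ^+ n * (1 - a * b * q ^+ n) * p n x a b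
      = (1 - a * b * q ^+ (2 * n)) * p n (q * x) a (b / q)
        - (1 - q ^+ n) * p (n - 1)%N x a b
    & b * q ^+ (n + 1) * (1 - a * q ^+ (n + 1)) * p (n + 1)%N x a b
      = (1 - a * b * q ^+ (2 * n + 2)) * (1 - q * b * x) * p n x a (q * b)
        - (1 - b * q ^+ (n + 1)) * p n x a b].
Proof.
have [q_gt0 q_lt1] := andP hq.
have q0C : q0%:C != 0 by rewrite eq_complex /= eqxx andbT gt_eqF.
have embed_neq1 (r : R) : r != 1 -> r%:C != 1.
  by move=> hr; rewrite eq_complex /= eqxx andbT.
have hqC i : q0%:C ^+ i.+1 != 1.
  by rewrite -rmorphXn embed_neq1 // lt_eqF // exprn_ilt1 // ltW.
have haC i : a0%:C * q0%:C ^+ i.+1 != 1.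
  by rewrite -rmorphXn -rmorphM embed_neq1 // ha.
case: n hn => // m _ x q a b p; rewrite /p {p} subn1 /=.
split.
- by rewrite expfzDr //; exact: little_qJacobi_transfer.
- exact: little_qJacobi_raise_a_lower_b.
- exact: little_qJacobi_dilation.
- exact: little_qJacobi_raise_degree.
Qed.
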